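(* Let $X$ be a metric space, $Y$ a normed vector space, and $F,G:X\rightrightarrows Y$ two multifunctions. Suppose that $F$ is calm at $(\overline{x},\overline{y})\in\operatorname{Gr}F$, that $G$ is calm at $(\overline{x},\overline{z})\in\operatorname{Gr}G$, and that $(F,G)$ is locally sum-stable around $(\overline{x},\overline{y},\overline{z})$. Then the multifunction $F+G$ is calm at $(\overline{x},\overline{y}+\overline{z})$. Moreover, $$\operatorname{clm}(F+G)(\overline{x},\overline{y}+\overline{z})\leq\operatorname{clm}F(\overline{x},\overline{y})+\operatorname{clm}G(\overline{x},\overline{z}).$$
   Context: $B(x,r)$ is the open ball; $d(x,A)=\inf_{a\in A}d(x,a)$ with $d(x,\emptyset)=\infty$; the excess is $e(A,B)=\sup\{d(a,B)\mid a\in A\}$ (with $e(\emptyset,B)=0$); $(F+G)(x)=F(x)+G(x)$ (Minkowski sum); $\operatorname{Gr}F=\{(x,y)\mid y\in F(x)\}$. $F$ is calm with constant $L>0$ at $(\overline{x},\overline{y})\in\operatorname{Gr}F$ if there exist neighborhoods $U$ of $\overline{x}$ and $V$ of $\overline{y}$ such that $e(F(x)\cap V,F(\overline{x}))\leq L\,d(x,\overline{x})$ for every $x\in U$; $F$ is calm if this holds for some $L>0$, and $\operatorname{clm}F(\overline{x},\overline{y})$ is the infimum of such $L$. For $\overline{y}\in F(\overline{x})$, $\overline{z}\in G(\overline{x})$, $(F,G)$ is locally sum-stable around $(\overline{x},\overline{y},\overline{z})$ if for every $\varepsilon>0$ there exists $\delta>0$ such that, for every $x\in B(\overline{x},\delta)$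 and every $w\in(F+G)(x)\cap B(\overline{y}+\overline{z},\delta)$, there exist $y\in F(x)\cap B(\overline{y},\varepsilon)$ and $z\in G(x)\cap B(\overline{z},\varepsilon)$ such that $w=y+z$. *)

(* Defs.v *)
From HB Require Import structures.
From mathcomp Require Import all_boot all_order all_algebra.
From mathcomp Require Import all_classical all_reals all_analysis.

Set Implicit Arguments.
Unset Strict Implicit.
Unset Printing Implicit Defensive.

Import Order.TTheory GRing.Theory Num.Theory.
Import numFieldNormedType.Exports.

Local Open Scope classical_set_scope.
Local Open Scope ring_scope.

Section multifunctions.
Context {R : realType} {X : metricType R} {Y : normedModType R}.
Implicit Types (F G : X -> set Y) (A B : set Y).

(* A multifunction from X to Y is a map X -> set Y; empty values are allowed. *)

Definition Gr F : set (X * Y) := [set p | F p.1 p.2].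

Definition mfsum F G : X -> set Y :=
  fun x => [set y + z | y in F x & z in G x].

(* [ereal_inf set0 = +oo], so the distance to the empty set is +oo. *)
Definition dist_to (y : Y) A : \bar R := ereal_inf [set `|y - a|%:E | a in A].

(* The first case is needed because [ereal_sup set0 = -oo]. *)
Definition excess A B : \bar R :=
  if A == set0 then 0%E else ereal_sup [set dist_to a B | a in A].

Definition calm_with F (x0 : X) (y0 : Y) (L : R) : Prop :=
  0 < L /\
  exists (U : set X) (V : set Y), [/\ nbhs x0 U, nbhs y0 V &
    forall x, U x -> (excess (F x `&` V) (F x0) <= (L * mdist x x0)%:E)%E].

Definition calm F (x0 : X) (y0 : Y) : Prop := exists L, calm_with F x0 y0 L.

(* An extended real, equal to +oo when F is not calm at (x0, y0). *)
Definition clm F (x0 : X) (y0 : Y) : \bar R :=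
  ereal_inf [set L%:E | L in calm_with F x0 y0].

Definition locally_sum_stable F G (x0 : X) (y0 z0 : Y) : Prop :=
  forall eps : R, 0 < eps -> exists2 delta : R, 0 < delta &
    forall x w, ball x0 delta x ->
      (mfsum F G x `&` ball (y0 + z0) delta) w ->
      exists y z, [/\ (F x `&` ball y0 eps) y, (G x `&` ball z0 eps) z
                    & w = y + z].

End multifunctions.

(* Main.v *)
Require Import Defs.
From mathcomp Require Import all_boot all_order all_algebra.
From mathcomp Require Import all_classical all_reals all_analysis.
From mathcomp Require Import lra.
Import Order.TTheory GRing.Theory Num.Theory.
Import numFieldNormedType.Exports.
Local Open Scope classical_set_scope.
Local Open Scope ring_scope.

(** Sum-stability lets each [w] in [mfsum F G x] near [y0 + z0], for [x] near [x0], split as [y + z]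
    with both summands inside the neighbourhoods where calmness of [F] and [G] applies. Distance to
    a set is subadditive under Minkowski sums ([dist_toD_le]), so constants [L] and [M] for [F] and
    [G] yield [L + M] for the sum ([calm_with_mfsum]). Taking infima over [L] and [M] independently
    gives the bound on [clm]. *)

Lemma dist_to_leP (R : realType) (Y : normedModType R) (y : Y) (A : set Y)
    (r : R) :
  (dist_to y A <= r%:E)%E <->
  (forall e : R, 0 < e -> exists2 a, A a & `|y - a| < r + e).
Proof.
split=> [yA e e0|yA].
- have : (dist_to y A < (r + e)%:E)%E.
    by apply: (le_lt_trans yA); rewrite lte_fin ltrDl.
  by move=> /ereal_inf_lt[_ [a Aa <-]]; rewrite lte_fin; exists a.
- apply/lee_addgt0Pr => e /yA[a Aa ya].
  apply: (@le_trans _ _ `|y - a|%:E); last by rewrite -EFinD lee_fin ltW.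
  by apply: ereal_inf_lbound; exists a.
Qed.

(** Infima need not be attained, so near-minimisers with slack [e / 2] each are added, using the
    triangle inequality. Real bounds [r] and [s] force [A] and [B] to be nonempty. *)
Lemma dist_toD_le (R : realType) (Y : normedModType R) (y z : Y)
    (A B : set Y) (r s : R) :
  (dist_to y A <= r%:E)%E -> (dist_to z B <= s%:E)%E ->
  (dist_to (y + z)%R [set (a + b)%R | a in A & b in B] <= (r + s)%:E)%E.
Proof.
move=> /dist_to_leP yA /dist_to_leP zB; apply/dist_to_leP => e e0.
have e20 : 0 < e / 2 by lra.
have [a Aa ya] := yA _ e20; have [b Bb zb] := zB _ e20.
exists (a + b); first by exists a => //; exists b.
rewrite opprD addrACA; apply: (le_lt_trans (ler_normD _ _)); lra.
Qed.

(** The condition [0 <= r] covers empty [A], whose excess is 0 while the right side is vacuous. *)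
Lemma excess_leP (R : realType) (Y : normedModType R) (A B : set Y) (r : R) :
  0 <= r ->
  (excess A B <= r%:E)%E <-> (forall a, A a -> (dist_to a B <= r%:E)%E).
Proof.
move=> r0; rewrite /excess; case: ifPn => [/eqP ->|_]; split=> //.
- move=> AB a Aa; apply: le_trans AB.
  by apply: ereal_sup_ubound; exists a.
- by move=> AB; apply: ge_ereal_sup => _ [a Aa <-]; exact: AB.
Qed.

Lemma calm_with_mfsum (R : realType) (X : metricType R) (Y : normedModType R)
    (F G : X -> set Y) (x0 : X) (y0 z0 : Y) (L M : R) :
  locally_sum_stable F G x0 y0 z0 ->
  calm_with F x0 y0 L -> calm_with G x0 z0 M ->
  calm_with (mfsum F G) x0 (y0 + z0) (L + M).
Proof.
move=> FG [L0 [U [V [x0U y0V FL]]]] [M0 [U' [V' [x0U' z0V' GM]]]].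
split; first exact: addr_gt0.
move: y0V z0V' => /nbhs_ballP[e /= e0 eV] /nbhs_ballP[e' /= e'0 eV'].
(* A single radius for sum-stability, small enough to place [y] in [V] and [z] in [V']. *)
have m0 : 0 < Num.min e e' by rewrite lt_min e0.
have [d d0 dFG] := FG _ m0.
exists (U `&` U' `&` ball x0 d), (ball (y0 + z0) d); split.
- by apply: filterI; [exact: filterI|exact: nbhsx_ballx].
- exact: nbhsx_ballx.
move=> x [[Ux U'x] dx].
have mx := mdist_ge0 x x0.
apply/excess_leP; first by apply: mulr_ge0 => //; lra.
move=> w /(dFG _ _ dx)[y [z [[Fy ey] [Gz ez] ->]]].
(* [mfsum F G x0] unfolds to the sum set of [dist_toD_le]. *)
rewrite mulrDl; apply: dist_toD_le.
- have /excess_leP := FL _ Ux; apply; first by rewrite mulr_ge0// ltW.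
  by split=> //; apply/eV/(le_ball _ ey); rewrite ge_min lexx.
- have /excess_leP := GM _ U'x; apply; first by rewrite mulr_ge0// ltW.
  by split=> //; apply/eV'/(le_ball _ ez); rewrite ge_min lexx orbT.
Qed.

(** One admissible constant bounds the infimum above, and positivity of all of them bounds it below
    by 0. Finiteness allows [clm] to be moved across inequalities in the extended reals. *)
Lemma clm_fin_num (R : realType) (X : metricType R) (Y : normedModType R)
    (F : X -> set Y) (x0 : X) (y0 : Y) :
  calm F x0 y0 -> clm F x0 y0 \is a fin_num.
Proof.
move=> [L FL]; rewrite ge0_fin_numE.
- by apply: le_lt_trans (ltry L); apply: ereal_inf_lbound; exists L.
- by apply: le_ereal_inf_tmp => _ [M [M0 _] <-]; rewrite lee_fin ltW.
Qed.

Theorem lemma3p6 (R : realType) (X : metricType R) (Y : normedModType R)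
    (F G : X -> set Y) (x0 : X) (y0 z0 : Y)
    (hF : Gr F (x0, y0)) (hG : Gr G (x0, z0))
    (cF : calm F x0 y0) (cG : calm G x0 z0)
    (hFG : locally_sum_stable F G x0 y0 z0) :
  calm (mfsum F G) x0 (y0 + z0) /\
  (clm (mfsum F G) x0 (y0 + z0)%R <= clm F x0 y0 + clm G x0 z0)%E.
Proof.
split.
  have [[L FL] [M GM]] := (cF, cG).
  by exists (L + M); exact: calm_with_mfsum.
(* Each [clm] in turn is isolated on the right by subtracting the other summand, so that its infimum
   can be replaced by an arbitrary admissible constant. *)
rewrite -leeBlDr ?clm_fin_num//; apply: le_ereal_inf_tmp => _ [L FL <-].
rewrite leeBlDr ?clm_fin_num// -leeBlDl//.
apply: le_ereal_inf_tmp => _ [M GM <-]; rewrite leeBlDl//.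
by apply: ereal_inf_lbound; exists (L + M) => //; exact: calm_with_mfsum.
Qed.
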